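(* The following assertion is false for open sets: ''for every bounded open set $D'\subset\mathbb{C}^n$, every convex cone $F\subset C(D')$ containing the constants, and every $g\in C(D')$, either $Sg\equiv-\infty$ on $D'$ or $Sg(z)=Ig(z)$ for all $z\in D'$.'' That is, there exist a bounded open set $D'\subset\mathbb{C}^n$, a convex cone $F\subset C(D')$ containing the constants and a function $g\in C(D')$ such that $Sg\not\equiv-\infty$ and $Sg(z)\ne Ig(z)$ for some $z\in D'$.
   Context: Let $D'\subset\mathbb{C}^n$ be a bounded set and let $F\subset C(D')$ be a convex cone of real-valued continuous functions on $D'$ containing the constants. For $z\in D'$ let $J^F_z(D')$ be the set of Borel probability measures $\mu$ with compact support contained in $D'$ such that $u(z)\le\int_{D'}u\,d\mu$ for all $u\in F$. For $g:D'\to\mathbb{R}$ and $z\in D'$ define $$Sg(z)=\sup\{u(z): u\in F,\ u\le g \text{ on } D'\},\qquad Ig(z)=\inf\Big\{\int_{D'}g\,d\mu : \mu\in J^F_z(D')\Big\}.$$ *)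

(* Defs.v *)
From mathcomp Require Export all_boot all_order all_algebra.
From mathcomp Require Export complex.
From mathcomp Require Export all_classical all_reals all_analysis.

Set Implicit Arguments.
Unset Strict Implicit.
Unset Printing Implicit Defensive.

Export Order.TTheory GRing.Theory Num.Theory numFieldNormedType.Exports.

Local Open Scope classical_set_scope.
Local Open Scope ring_scope.
Local Open Scope complex_scope.

(* C^n.  The topology on R[i] is carried by the alias R[i]^o; the norm on row
   vectors is the maximum of the moduli of the coordinates. *)
Notation Cn R n := ('rV[R[i]^o]_n).

Notation borelCn R n := (g_sigma_algebraType (@open (Cn R n))).

(* Functions on a subset D of C^n are represented by total functions of which
   only the values on D matter: continuity, the constraint u <= g and the
   integrals below all refer to D only.  A family F of functions on D is thus
   represented by a set of (arbitrary) total extensions of its members. *)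
Definition Cfun (R : realType) (n : nat) (D : set (Cn R n)) :
    set (Cn R n -> R) :=
  [set u | {within D, continuous u}].

Definition convex_cone (R : realType) (n : nat) (F : set (Cn R n -> R)) :
    Prop :=
  forall (u v : Cn R n -> R) (a b : R), F u -> F v -> 0 <= a -> 0 <= b ->
    F (fun x => a * u x + b * v x).

Definition supp (R : realType) (n : nat)
    (mu : probability (borelCn R n) R) : set (Cn R n) :=
  [set z | forall U : set (Cn R n), open U -> U z -> (0 < mu U)%E].

(* A Borel probability measure on D with compact support is identified with
   its extension by zero to C^n.  Conversely a Borel probability measure on C^n
   is concentrated on its support, because C^n is second countable, so
   [supp mu `<=` D] forces mu to be carried by D. *)
Definition Jensen (R : realType) (n : nat) (D : set (Cn R n))
    (F : set (Cn R n -> R)) (z : Cn R n) : set (probability (borelCn R n) R) :=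
  [set mu | [/\ compact (supp mu), supp mu `<=` D &
    forall u : Cn R n -> R, F u -> ((u z)%:E <= \int[mu]_(x in D) (u x)%:E)%E]].

(* The supremum and the infimum are taken in the extended reals; in particular
   Sfun takes the value -oo when no member of F lies below g on D. *)
Definition Sfun (R : realType) (n : nat) (D : set (Cn R n))
    (F : set (Cn R n -> R)) (g : Cn R n -> R) (z : Cn R n) : \bar R :=
  ereal_sup [set (u z)%:E |
    u in [set u : Cn R n -> R | F u /\ forall x, D x -> u x <= g x]].

Definition Ifun (R : realType) (n : nat) (D : set (Cn R n))
    (F : set (Cn R n -> R)) (g : Cn R n -> R) (z : Cn R n) : \bar R :=
  ereal_inf [set (\int[mu]_(x in D) (g x)%:E)%E | mu in Jensen D F z].

(* Main.v *)
(* On the unit ball D write r for the norm, and let F be the cone generated by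
   the constants and h = - r (1 - r), and g = - r.  As h has a strict maximum
   over D at 0, the only Jensen measure at 0 is the Dirac mass, so Ig(0) =
   g(0) = 0.  But h also tends to its maximum 0 at the boundary of D, where g
   tends to -1, so a + b h <= g forces a <= -1, and Sg(0) = -1. *)
Require Import Defs.
From mathcomp Require Import measurable_realfun ring lra.

Local Open Scope classical_set_scope.
Local Open Scope ring_scope.

Section RealNorm.
Variables (R : realType) (V : normedModType R[i]).
Implicit Types x y : V.

(** The norm of a normed module over [R[i]] takes values in [R[i]]. These values are real, so the
    real part loses nothing and yields a function into [R]. *)
Definition rnorm x : R := complex.Re `|x|.

Lemma rnormE x : `|x| = (rnorm x)%:C%C.
Proof. by rewrite RRe_real// normr_real. Qed.

Lemma rnorm_ge0 x : 0 <= rnorm x.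
Proof. by rewrite -ler0c -rnormE. Qed.

Lemma rnorm0 : rnorm 0 = 0.
Proof. by rewrite /rnorm normr0. Qed.

Lemma rnorm_eq0 x : rnorm x = 0 -> x = 0.
Proof. by move=> x0; apply/eqP; rewrite -normr_eq0 rnormE x0. Qed.

Lemma rnormZ (a : R) x : 0 <= a -> rnorm (a%:C%C *: x) = a * rnorm x.
Proof.
move=> a0; rewrite /rnorm normrZ ger0_norm ?ler0c// (rnormE x).
by rewrite /= mulr0 subr0.
Qed.

Lemma ler_dist_rnorm x y : `|rnorm x - rnorm y| <= rnorm (x - y).
Proof.
have tri u v : rnorm u - rnorm v <= rnorm (u - v).
  by rewrite -lecR rmorphB/= -!rnormE lerB_dist.
by rewrite ler_norml tri andbT lerNl opprB /rnorm -(distrC y) tri.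
Qed.

Lemma continuous_rnorm : continuous rnorm.
Proof.
move=> x; apply/cvgrPdist_lt => e e0.
apply/nbhs_ballP; exists (e%:C%C); first by rewrite /= -[0]/(0%:C%C) ltcR.
move=> y; rewrite -ball_normE /= rnormE ltcR.
exact/le_lt_trans/ler_dist_rnorm.
Qed.

Lemma unit_ballE : ball (0 : V) 1 = [set x | rnorm x < 1].
Proof.
rewrite -ball_normE; apply/seteqP.
by split=> x /=; rewrite -[rnorm x < 1]ltcR sub0r normrN rnormE.
Qed.

(** Rescaling [v] gives vectors of every norm; this supplies points of the ball arbitrarily close to
    its boundary. *)
Lemma rnorm_surj (v : V) (t : R) : v != 0 -> 0 <= t -> exists x, rnorm x = t.
Proof.
move=> v0 t0; have v1 : rnorm v != 0 by apply: contra_neq v0 => /rnorm_eq0.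
exists ((t / rnorm v)%:C%C *: v).
by rewrite rnormZ ?divfK// divr_ge0// rnorm_ge0.
Qed.

End RealNorm.

(** Open intervals generate the Borel sets of [R], and their preimages under [f] are open, hence
    among the generators of [borelCn]. *)
Lemma measurable_fun_borel_continuous (R : realType) (n : nat)
    (f : Cn R n -> R) : continuous f ->
  measurable_fun [set: borelCn R n] (f : borelCn R n -> R).
Proof.
move=> /continuousP cf.
apply: (measurability _ (RGenOpens.measurableE R)) => _ [_ [a [b ->] <-]].
rewrite setTI; apply: sub_sigma_algebra; apply: cf.
exact: interval_open.
Qed.

(** Since [h] is nonpositive, the integral of [|h|] is minus that of [h], hence zero. So [h], and
    with it [g], vanishes almost everywhere on [D]. *)
Lemma integral_eq0_of_max (R : realType) (d : measure_display)
    (T : measurableType d) (mu : {measure set T -> \bar R}) (D : set T)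
    (h g : T -> R) : measurable D -> measurable_fun D h ->
  measurable_fun D g -> (forall x, D x -> h x <= 0) ->
  (forall x, D x -> h x = 0 -> g x = 0) ->
  (0 <= \int[mu]_(x in D) (h x)%:E)%E -> (\int[mu]_(x in D) (g x)%:E = 0)%E.
Proof.
move=> mD mh mg h_le0 hg0 int_h.
have mEh : measurable_fun D (EFin \o h) by exact/measurable_EFinP.
have int_abs : (\int[mu]_(x in D) `|(h x)%:E| = 0)%E.
  apply/eqP; rewrite eq_le integral_ge0// andbT -oppe_ge0.
  rewrite -integral_ge0N//; apply: (le_trans int_h).
  rewrite le_eqVlt; apply/orP; left; apply/eqP/eq_integral => x.
  rewrite inE => /h_le0 hx.
  by rewrite abse_EFin ler0_norm// EFinN oppeK.
move/(ae_eq_integral_abs mu mD mEh): int_abs => h0.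
rewrite (ae_eq_integral (cst 0%E))//; first by rewrite integral0.
  exact/measurable_EFinP.
by apply: filterS h0 => x h0x Dx; have [/hg0 ->] := h0x Dx.
Qed.

Theorem mainTheorem3 (R : realType) (n : nat) (hn : (0 < n)%N) :
  exists (D : set (Cn R n)) (F : set (Cn R n -> R)) (g : Cn R n -> R),
    [/\ open D, bounded_set D & Cfun D g] /\
    [/\ F `<=` Cfun D, convex_cone F & forall c : R, F (cst c)] /\
    ~ (forall z, D z -> Sfun D F g z = -oo%E) /\
    (exists z, D z /\ Sfun D F g z <> Ifun D F g z).
Proof.
pose r : Cn R n -> R := @rnorm R (Cn R n).
pose D : set (Cn R n) := ball 0 1.
have DE x : D x <-> r x < 1 by rewrite /D unit_ballE.
pose h x := r x * (r x - 1).
pose g x := - r x.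
have cr : continuous r by exact: continuous_rnorm.
have ch : continuous h.
  move=> x; apply: continuousM; first exact: cr.
  by apply: continuousB; [exact: cr|exact: cst_continuous].
have cg : continuous g by move=> x; apply: continuousN; exact: cr.
pose F : set (Cn R n -> R) :=
  [set u | exists a b : R, 0 <= b /\ u = (fun x => a + b * h x)].
have r_ge0 x : 0 <= r x by exact: rnorm_ge0.
have r00 : r 0 = 0 by exact: rnorm0.
have h00 : h 0 = 0 by rewrite /h r00 mul0r.
have D0 : D 0 by apply/DE; rewrite r00.
have oD : open D by exact: ball_open.
have Fcst c : F (cst c).
  by exists c, 0; split => //; apply/funext => x; rewrite mul0r addr0.
have S_ge : ((-1)%:E <= Sfun D F g 0)%E.
  apply: ereal_sup_ubound; exists (cst (-1)) => //; split => // x /DE.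
  by rewrite /g lerN2 => /ltW.
have S_le : (Sfun D F g 0 <= (-1)%:E)%E.
  apply: ge_ereal_sup => _ [u [[a [b [b0 ->]]] uleg] <-].
  (* As [h 0 = 0], the value of [u] at 0 is [a]. If [a > -1], then [u <= g] must fail at a point
     near the boundary. *)
  rewrite lee_fin h00 mulr0 addr0 leNgt; apply/negP => a1.
  have v0 : const_mx 1 != 0 :> Cn R n.
    apply/eqP => /matrixP/(_ ord0 (Ordinal hn)).
    by rewrite !mxE => /eqP; rewrite oner_eq0.
  (* at radius 1 - e, [a + b h <= g] reads [a + 1 <= e + b e (1 - e)],
     whereas the choice of e gives [e (1 + b) < a + 1] *)
  pose e := (a + 1) / (a + 1 + (b + 1)).
  have a1_gt0 : 0 < a + 1 by lra.
  have den_gt0 : 0 < a + 1 + (b + 1) by lra.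
  have e_gt0 : 0 < e by rewrite divr_gt0.
  have eE : e * (a + 1 + (b + 1)) = a + 1 by rewrite divfK// gt_eqF.
  have e_lt1 : e < 1 by rewrite ltr_pdivrMr//; lra.
  have [|x rx] := @rnorm_surj R (Cn R n) _ (1 - e) v0; first by lra.
  have := uleg x; rewrite DE /h /g /r rx => /(_ ltac:(lra)); nra.
have I_ge : (0 <= Ifun D F g 0)%E.
  apply: le_ereal_inf_tmp => _ [mu [_ _ muF] <-].
  have mD : measurable (D : set (borelCn R n)) by exact: sub_sigma_algebra.
  have Fh : F h.
    by exists 0, 1; split => //; apply/funext => x; rewrite add0r mul1r.
  (* The Jensen inequality for [h] at 0 says that the integral of [h] is at least [h 0 = 0], the
     maximum of [h] on [D]. *)
  rewrite (@integral_eq0_of_max _ _ (borelCn R n) mu D h g)//.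
  - apply: measurable_funTS; exact: measurable_fun_borel_continuous.
  - apply: measurable_funTS; exact: measurable_fun_borel_continuous.
  - move=> x /DE r1; have := r_ge0 x; rewrite /h; nra.
  (* Inside the ball the factor [r x - 1] is nonzero, so [h x = 0] forces [r x = 0]. *)
  - move=> x /DE r1 /eqP; rewrite /h mulf_eq0 subr_eq0 (lt_eqF r1) orbF.
    by rewrite /g => /eqP ->; rewrite oppr0.
  - by have := muF _ Fh; rewrite h00.
exists D, F, g; split.
  split => //; last exact: continuous_subspaceT.
  exists 1; split; first exact: real1.
  move=> M M1 x; rewrite /= -/(D x) /D -ball_normE /= sub0r normrN => x1.
  exact/ltW/(lt_trans x1).
split.
  split => //.
  - move=> u [a [b [_ ->]]]; apply: continuous_subspaceT => x.
    exact: (cvgD (cvg_cst a) (cvgM (cvg_cst b) (ch x))).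
  - move=> _ _ a b [a1 [b1 [b10 ->]]] [a2 [b2 [b20 ->]]] a0 b0.
    exists (a * a1 + b * a2), (a * b1 + b * b2); split.
      by rewrite addr_ge0// mulr_ge0.
    by apply/funext => x; ring.
split.
  by move=> /(_ 0 D0) S0; move: S_ge; rewrite S0.
(* Equality at 0 would give [0 <= -1]. *)
exists 0; split => // SI.
by move: S_le; rewrite SI => /(le_trans I_ge); rewrite lee_fin; lra.
Qed.
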